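(* Let $G$ be a graph with exactly two components $G_1$ and $G_2$. Then $G$ is niche-realizable if and only if there are nonnegative integers $a_1$, $b_1$, $a_2$, and $b_2$ such that $2a_1+b_1 \le |V(G_1)|$, $2a_2+b_2 \le |V(G_2)|$, $1 \le a_1+b_1 \le 2^{a_2+b_2-1}$, $1 \le a_2+b_2 \le 2^{a_1+b_1-1}$, and for each $i=1,2$, $G_i$ is an expansion of a complete $(a_i+b_i)$-partite graph with $a_i$ partite sets of size two and $b_i$ partite sets of size one.
   Context: All graphs are simple. A bipartite tournament is an orientation of a complete bipartite graph $K_{m,n}$. The niche graph of a digraph $D$ is the graph with vertex set $V(D)$ in which distinct $u,v$ are adjacent iff there is a vertex $w$ with $(u,w),(v,w)\in A(D)$, or with $(w,u),(w,v)\in A(D)$. A graph is niche-realizable if it is the niche graph of some bipartite tournament. For a graph $G$, a vertex $v$ and a finite set $K$ disjoint from $V(G)$, replacing $v$ with a clique formed by $K$ gives the graph with vertex set $(V(G)\cup K)\setminus\{v\}$ and edge set $E(G-v)\cup\{wx : w\ne x, w,x\in K\}\cup\{uw: uv\in E(G), w\in K\}$. A graph is an expansion of $G$ if it is obtained by replacing each vertex of $G$ with a clique (possibly of size one). *)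

(* Defs.v *)
From mathcomp Require Import all_boot.

Set Implicit Arguments.
Unset Strict Implicit.
Unset Printing Implicit Defensive.

Record sgraph := SGraph {
  vertex :> finType;
  edge : rel vertex;
  edge_sym : symmetric edge;
  edge_irrefl : irreflexive edge }.

Arguments edge {s}.

Definition iso (G H : sgraph) : Prop :=
  exists2 f : G -> H, bijective f & forall x y, edge (f x) (f y) = edge x y.

Section Induced.
Variables (G : sgraph) (A : {set G}).

Definition induced_rel : rel {x : G | x \in A} :=
  fun x y => edge (val x) (val y).

Fact induced_sym : symmetric induced_rel.
Proof. by move=> x y; apply: edge_sym. Qed.

Fact induced_irrefl : irreflexive induced_rel.
Proof. by move=> x; apply: edge_irrefl. Qed.

Definition induced : sgraph := SGraph induced_sym induced_irrefl.
End Induced.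

Definition components (G : sgraph) : {set {set G}} :=
  equivalence_partition (connect (@edge G)) [set: G].

Section CompleteMultipartite.
Variables (I : finType) (s : I -> nat).

Definition multipartite_rel : rel {i : I & 'I_(s i)} :=
  fun x y => tag x != tag y.

Fact multipartite_sym : symmetric multipartite_rel.
Proof. by move=> x y; rewrite /multipartite_rel eq_sym. Qed.

Fact multipartite_irrefl : irreflexive multipartite_rel.
Proof. by move=> x; rewrite /multipartite_rel eqxx. Qed.

Definition complete_multipartite : sgraph :=
  SGraph multipartite_sym multipartite_irrefl.
End CompleteMultipartite.

Definition complete_bipartite (m n : nat) : sgraph :=
  complete_multipartite (fun i : bool => if i then m else n).

Definition complete_multipartite21 (a b : nat) : sgraph :=
  complete_multipartite (fun i : 'I_a + 'I_b => if i is inl _ then 2 else 1).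

Definition orientation (G : sgraph) (arc : rel G) : Prop :=
  forall u v, ~~ (arc u v && arc v u) /\ (arc u v || arc v u) = edge u v.

Section NicheGraph.
Variables (V : finType) (arc : rel V).

Definition niche_rel : rel V := fun u v =>
  (u != v) && [exists w, arc u w && arc v w || arc w u && arc w v].

Fact niche_sym : symmetric niche_rel.
Proof.
move=> u v; rewrite /niche_rel eq_sym; congr (_ && _).
by apply: eq_existsb => w; rewrite andbC (andbC (arc w u)).
Qed.

Fact niche_irrefl : irreflexive niche_rel.
Proof. by move=> u; rewrite /niche_rel eqxx. Qed.

Definition niche_graph : sgraph := SGraph niche_sym niche_irrefl.
End NicheGraph.

Definition niche_realizable (G : sgraph) : Prop :=
  exists (m n : nat) (arc : rel (complete_bipartite m n)),
    [/\ 0 < m, 0 < n, orientation arc & iso G (niche_graph arc)].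

Section ReplaceClique.
Variables (G : sgraph) (v : G) (K : finType).

Definition replace_rel : rel ({x : G | x != v} + K)%type := fun x y =>
  match x, y with
  | inl x, inl y => edge (val x) (val y)
  | inl x, inr _ => edge (val x) v
  | inr _, inl y => edge (val y) v
  | inr k, inr l => k != l
  end.

Fact replace_sym : symmetric replace_rel.
Proof. by move=> [x|k] [y|l] //=; [apply: edge_sym | rewrite eq_sym]. Qed.

Fact replace_irrefl : irreflexive replace_rel.
Proof. by move=> [x|k] /=; [apply: edge_irrefl | rewrite eqxx]. Qed.

Definition replace_clique : sgraph := SGraph replace_sym replace_irrefl.

Definition remaining (S : {set G}) : {set replace_clique} :=
  [set x : replace_clique | if x is inl u then val u \in S else false].
End ReplaceClique.

(* [expands S H]: H is obtained, up to isomorphism, from the graph carrying S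
   by replacing each vertex of S exactly once with a nonempty clique. *)
Inductive expands : forall G : sgraph, {set G} -> sgraph -> Prop :=
| expands_done (G H : sgraph) : iso G H -> expands (set0 : {set G}) H
| expands_step (G H : sgraph) (S : {set G}) (v : G) (K : finType) :
    v \in S -> 0 < #|K| -> expands (remaining v K S) H -> expands S H.

Definition is_expansion (H G : sgraph) : Prop := expands [set: G] H.

(* Main.v *)
Require Import Defs.
From mathcomp Require Import all_boot.

(** Inside one part of a bipartite tournament, two vertices are nonadjacent in
    the niche graph exactly when their rows in the bipartite adjacency matrix
    are complementary, and there are no niche edges between the two parts. So
    the parts are the two components, and each is obtained from the set of its
    rows up to complement by splitting a class into two cliques when both a row
    and its complement occur. Normalizing one row and one column of the matrix
    to zero, the row classes become subsets of the set of nonzero column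
    classes, which gives the exponential bounds. Conversely, when
    [k <= l <= 2 ^ (k - 1)], a [k] by [l] matrix whose first row vanishes and
    whose columns are distinct and include zero and the other unit vectors
    has pairwise distinct rows and columns, even up to complement. *)

Set Implicit Arguments.
Unset Strict Implicit.
Unset Printing Implicit Defensive.

(** * Expansions as vertex maps *)

Lemma leq_card_surj (T T' : finType) (f : T -> T') :
  (forall y, exists x, f x = y) -> #|T'| <= #|T|.
Proof.
move=> fs; apply: leq_trans (leq_image_card f T).
by apply/subset_leq_card/subsetP=> y _; have [x <-] := fs y; apply: codom_f.
Qed.

(** The fibre over [v] is the clique that replaces [v], so a single map records the whole sequence
    of replacements in [expands]. *)
Definition expansion_map (G H : sgraph) (f : H -> G) : Prop :=
  (forall v, exists x, f x = v) /\
  forall x y, edge x y = (x != y) && ((f x == f y) || edge (f x) (f y)).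

(** [S] holds the vertices still to be replaced, so those outside [S] must have fibres of size one.
    Each replacement composes the map with the projection [p] that collapses [K] to [v]. *)
Lemma expands_map (G H : sgraph) (S : {set G}) :
  expands S H ->
  exists2 f : H -> G, expansion_map f &
    forall x y, f x = f y -> f x \notin S -> x = y.
Proof.
elim=> {G H S} [G H [g [h gK hK] gE]|G H S v K vS K0 _ [f [fs fE] fI]].
  exists h; last by move=> x y /(can_inj hK).
  split=> [v|x y]; first by exists (g v); rewrite gK.
  rewrite -gE !hK (can_eq hK); case: (eqVneq x y) => //= ->.
  exact: edge_irrefl.
pose p (z : replace_clique v K) : G := if z is inl u then val u else v.
have pE z1 z2 : edge z1 z2 = (z1 != z2) && ((p z1 == p z2) || edge (p z1) (p z2)).
  case: z1 z2 => [u1|k1] [u2|k2] /=.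
  - rewrite /= (inj_eq (@inl_inj _ _)) val_eqE; case: eqVneq => //= ->.
    exact: edge_irrefl.
  - by rewrite (negbTE (valP u1)).
  - by rewrite eq_sym (negbTE (valP u2)) /= edge_sym.
  - by rewrite (inj_eq (@inr_inj _ _)) eqxx andbT.
exists (p \o f).
  split=> [w|x y] /=.
    have [->|wv] := eqVneq w v.
      have /card_gt0P[k _] := K0.
      by have [x fx] := fs (inr k); exists x; rewrite fx.
    by have [x fx] := fs (inl (Sub w wv)); exists x; rewrite fx.
  rewrite fE pE; case: (eqVneq (f x) (f y)) => [->|] /=; last by [].
  by rewrite eqxx.
move=> x y /= pxy pS; apply: fI.
  move: pxy pS; case: (f x) (f y) => [u1|k1] [u2|k2] /=.
  - by move/val_inj->.
  - by move=> -> /negP.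
  - by move=> _ /negP.
  - by move=> _ /negP.
by move: pS; case: (f x) => [u|k] /=; rewrite inE //= => /negP.
Qed.

(** Induction on the size of [S]: some [v] in [S] is replaced by its own fibre under [f], and [f]
    lifts to the new graph with the points of that fibre separated. *)
Lemma map_expands (G H : sgraph) (S : {set G}) (f : H -> G) :
  expansion_map f -> (forall x y, f x = f y -> f x \notin S -> x = y) ->
  expands S H.
Proof.
have [n] := ubnP #|S|; elim: n => // n IH in G S f * => Sn [fs fE] fI.
have [S0|[v vS]] := set_0Vmem S.
  rewrite S0; apply: expands_done.
  have finj x y : f x = f y -> x = y by move/fI; apply; rewrite S0 inE.
  have fbij : bijective f.
    exact: inj_card_bij finj (leq_card_surj fs).
  case: (fbij) => g fK gK; exists g; first by exists f.
  move=> x y; rewrite fE !gK (can_eq gK).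
  by case: (eqVneq x y) => //= ->; rewrite edge_irrefl.
pose K : finType := {x : H | f x == v}.
(* The match on [boolP] keeps the proof that [x] lies in the fibre or outside it, which each sigma
   type needs. *)
pose f' (x : H) : replace_clique v K :=
  match boolP (f x == v) with
  | AltTrue e => inr (Sub x e)
  | AltFalse e => inl (Sub (f x) e)
  end.
pose p (z : replace_clique v K) : G := if z is inl u then val u else v.
have pf x : p (f' x) = f x.
  by rewrite /f'; destruct (boolP (f x == v)) as [e|e]; rewrite /= ?(eqP e).
have f'v x : f x = v -> exists2 k : K, f' x = inr k & val k = x.
  move=> fx; rewrite /f'; destruct (boolP (f x == v)) as [e|e]; last by case/eqP: (e).
  by exists (Sub x e).
have f'nv x : f x != v -> exists2 u, f' x = inl u & val u = f x.
  move=> fx; rewrite /f'; destruct (boolP (f x == v)) as [e|e]; first by case/negP: fx.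
  by exists (Sub (f x) e).
have [x0 fx0] := fs v.
apply: (expands_step (v := v) (K := K)) => //.
  by apply/card_gt0P; exists (Sub x0 (introT eqP fx0)).
apply: (IH _ _ f').
(* The measure drops because [p] maps the remaining set injectively into [S] without [v]. *)
- rewrite -ltnS; apply: leq_trans Sn; rewrite ltnS (cardsD1 v S) vS add1n ltnS.
  have pinj : {in remaining v K S &, injective p}.
    move=> [u1|k1] [u2|k2]; rewrite !inE //= => _ _; by move/val_inj->.
  rewrite -(card_in_imset pinj); apply: subset_leq_card.
  apply/subsetP=> _ /imsetP[[u|k] + ->]; rewrite !inE //= => ->.
  by rewrite (valP u).
- split=> [[u|k]|x y].
  + have [x fx] := fs (val u); exists x.
    have fxv : f x != v by rewrite fx (valP u).
    by have [u' -> uE] := f'nv x fxv; congr inl; apply: val_inj; rewrite uE.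
  + exists (val k); have [k' -> kE] := f'v (val k) (eqP (valP k)).
    by congr inr; apply: val_inj.
  + rewrite fE; case: (eqVneq x y) => //= xy.
    have [fx|fx] := eqVneq (f x) v; have [fy|fy] := eqVneq (f y) v.
    * have [k1 -> k1E] := f'v x fx; have [k2 -> k2E] := f'v y fy.
      by rewrite fx fy eqxx /= -val_eqE k1E k2E xy orbT.
    * have [k1 -> k1E] := f'v x fx; have [k2 -> k2E] := f'nv y fy.
      by rewrite fx eq_sym (negbTE fy) /= k2E edge_sym.
    * have [k1 -> k1E] := f'nv x fx; have [k2 -> k2E] := f'v y fy.
      by rewrite fy (negbTE fx) /= k1E.
    * have [k1 -> k1E] := f'nv x fx; have [k2 -> k2E] := f'nv y fy.
      by rewrite (inj_eq (@inl_inj _ _)) -val_eqE /= k1E k2E.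
- move=> x y e nS; have fxy : f x = f y by rewrite -!pf e.
  have [fx|fx] := eqVneq (f x) v.
    have [k1 e1 k1E] := f'v x fx; have [k2 e2 k2E] := f'v y (etrans (esym fxy) fx).
    by move: e; rewrite e1 e2 -k1E -k2E => -[->].
  apply: fI => //; have [u e1 uE] := f'nv x fx.
  by move: nS; rewrite e1 inE uE.
Qed.

Lemma is_expansionP (H G : sgraph) :
  is_expansion H G <-> exists f : H -> G, expansion_map f.
Proof.
split=> [/expands_map[f fE _]|[f fE]]; first by exists f.
by apply: (map_expands fE) => x y _; rewrite inE.
Qed.

(** * Twin classes and expansions of complete multipartite graphs *)

(* Vertices of [C] are coded by [(q, t)] in [P * bool], and distinct vertices
   are nonadjacent exactly when they have the same [q] and opposite [t]. *)
Definition twin_paired (G : sgraph) (C : {set G}) (P : finType) : Prop :=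
  exists (q : G -> P) (t : G -> bool),
    (forall p, exists2 x, x \in C & q x = p) /\
    {in C &, forall x y,
      edge x y = (x != y) && ((q x != q y) || (t x == t y))}.

(** Used to number the classes so that those in [D] index the partite sets of size two. *)
Lemma sum_set_bij (P : finType) (D : {set P}) :
  exists2 g : P -> 'I_#|D| + 'I_#|~: D|, bijective g &
    forall p, (if g p is inl _ then true else false) = (p \in D).
Proof.
pose h (z : 'I_#|D| + 'I_#|~: D|) : P :=
  match z with inl i => enum_val i | inr j => enum_val j end.
have hD z : (h z \in D) = (if z is inl _ then true else false).
  by case: z => i /=; have := enum_valP i; rewrite ?inE // => /negbTE.
have hinj : injective h.
  move=> z1 z2 e; have := hD z1; rewrite e hD.
  by case: z1 z2 e => [i|i] [j|j] //= /enum_val_inj->.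
have [g hK gK] : bijective h.
  by apply: inj_card_bij hinj _; rewrite card_sum !card_ord cardsC.
by exists g; [exists h | move=> p; rewrite -hD gK].
Qed.

Lemma twin_paired_expansion (G : sgraph) (C : {set G}) (P : finType) :
  twin_paired C P ->
  exists a b, [/\ a + b = #|P|, 2 * a + b <= #|induced C| &
    is_expansion (induced C) (complete_multipartite21 a b)].
Proof.
case=> q [t [qs qE]].
(* The classes in which both values of [t] occur split into two nonadjacent cliques; every other
   class is a single clique. *)
pose D := [set p | [forall c, [exists x in C, (q x == p) && (t x == c)]]].
have [g [h gK hK] gD] := sum_set_bij D.
pose side (z : 'I_#|D| + 'I_#|~: D|) := if z is inl _ then 2 else 1.
(* The bit [t] picks a vertex of the partite set only when that set has size two. *)
pose pos z (c : bool) : 'I_(side z) :=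
  match z return 'I_(side z) with inl _ => inord c | inr _ => ord0 end.
pose f (x : induced C) : complete_multipartite21 #|D| #|~: D| :=
  existT (fun z => 'I_(side z)) (g (q (val x))) (pos (g (q (val x))) (t (val x))).
have tD x y : x \in C -> y \in C -> q x = q y -> q y \notin D -> t x = t y.
  move=> xC yC e; apply: contraNeq => txy; rewrite inE; apply/forallP=> c.
  have [tc|tc] := eqVneq (t x) c; apply/existsP.
    by exists x; rewrite xC e tc !eqxx.
  exists y; rewrite yC eqxx /=.
  by move: txy tc; case: (t x) (t y) c => [] [] [].
have posE x y : x \in C -> y \in C -> q x = q y ->
    (pos (g (q y)) (t x) == pos (g (q y)) (t y)) = (t x == t y).
  move=> xC yC e; have := tD x y xC yC e; rewrite -gD.
  case: (g (q y)) => [i|j] /= H; last by rewrite H ?eqxx.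
  have lt2 (c : bool) : c < 2 by case: c.
  rewrite -val_eqE /= !inordK ?lt2 //.
  by case: (t x) (t y) => [] [].
have fE : expansion_map f.
  split=> [[z c]|x y].
    have [gz|gz] := boolP (h z \in D).
      move: (gz); rewrite inE => /forallP/(_ (val c == 1)) /existsP[x].
      case/and3P=> xC /eqP qx /eqP tx; exists (Sub x xC).
      rewrite /f /= qx tx hK; congr existT.
      move: gz; rewrite -gD hK; case: z c {qx tx} => //= i c _.
      by apply: val_inj; rewrite /= inordK; case: c => [[|[|]]].
    have [x xC qx] := qs (h z); exists (Sub x xC).
    rewrite /f /= qx hK; congr existT.
    move: gz; rewrite -gD hK; case: z c {qx} => //= j c _.
    by rewrite (ord1 c).
  have -> : edge x y = edge (val x) (val y) by [].
  rewrite qE ?(valP x) ?(valP y) // -[x == y]/(val x == val y); congr (_ && _).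
  have -> : edge (f x) (f y) = (g (q (val x)) != g (q (val y))) by [].
  rewrite (can_eq gK); case: eqVneq => [e|_] /=; last first.
    by rewrite orbT.
  by rewrite orbF /f e eq_Tagged /= posE ?(valP x) ?(valP y).
exists #|D|, #|~: D|; split; first exact: cardsC.
  (* The multipartite graph has [2 * a + b] vertices, and [f] maps [C] onto them. *)
  have -> : 2 * #|D| + #|~: D| = #|complete_multipartite21 #|D| #|~: D| |.
    rewrite card_tagged sumnE big_map big_enum big_sumType /=.
    under eq_bigr do rewrite card_ord.
    under [X in _ = _ + X]eq_bigr do rewrite card_ord.
    by rewrite !sum_nat_const !card_ord muln1 mulnC.
  by case: fE => /leq_card_surj.
by apply/is_expansionP; exists f.
Qed.

Lemma expansion_twin_paired (G : sgraph) (C : {set G}) (a b : nat) :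
  0 < a + b -> is_expansion (induced C) (complete_multipartite21 a b) ->
  twin_paired C ('I_a + 'I_b)%type.
Proof.
(* Positivity of [a + b] supplies [p0], the value given to [q] outside [C]. *)
rewrite -[a in a + b]card_ord -[b in _ + b]card_ord -card_sum => /card_gt0P[p0 _].
case/is_expansionP=> f [fs fE].
pose ext T (d : T) (k : induced C -> T) (x : G) := oapp k d (insub x).
have extE T d k (x : induced C) : ext T d k (val x) = k x by rewrite /ext valK.
pose q0 (x : induced C) : 'I_a + 'I_b := tag (f x).
pose t0 (x : induced C) : bool := val (tagged (f x)) == 0.
exists (ext _ p0 q0), (ext _ true t0); split=> [p|x y xC yC].
  pose c : 'I_(if p is inl _ then 2 else 1) :=
    match p return 'I_(if p is inl _ then 2 else 1) with
    | inl _ => ord0 | inr _ => ord0 end.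
  have [x fx] := fs (existT _ p c); exists (val x); first exact: valP.
  by rewrite extE /q0 fx.
pose u : induced C := Sub x xC; pose v : induced C := Sub y yC.
rewrite -[x]/(val u) -[y]/(val v) !extE -[edge (val u) _]/(edge u v) fE.
congr (_ && _); rewrite -[edge _ _]/(q0 u != q0 v) orbC /q0 /t0.
case: (f u) (f v) => [z c] [z' c'] /=.
case: (eqVneq z z') => //= e; case: z' / e c' => c'.
rewrite eq_Tagged /= -val_eqE /=.
by case: z c c' => i [[|[|]]] //= ? [[|[|]]].
Qed.

(** * Bipartite tournaments as 0-1 matrices *)

(** An entry [r u w] says whether the arc between [u] in [C] and [w] outside goes from [u] to [w].
    Agreement of two rows at [w] thus makes [w] a common out-neighbour or a common in-neighbour. *)
Definition niche_side (G : sgraph) (C : {set G}) (r : G -> G -> bool) : Prop :=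
  {in C &, forall u v,
    edge u v = (u != v) && [exists w in ~: C, r u w == r v w]}.

(** This moves the tournament onto the vertices of [G], so that isomorphisms and ordinals no longer
    appear. A common neighbour of two vertices lies in the opposite part, which rules out niche
    edges across and leaves one row condition for each part. *)
Lemma niche_realizableP (G : sgraph) :
  niche_realizable G <-> exists (C : {set G}) (r : G -> G -> bool),
    [/\ C != set0, ~: C != set0, {in C & ~: C, forall u v, ~~ edge u v},
        niche_side C r & niche_side (~: C) (fun u v => r v u)].
Proof.
split=> [[m [n [arc [m0 n0 arcP [f fbij fE]]]]]|].
  case: (fbij) => g fK gK.
  pose side (x : G) : bool := tag (f x : complete_bipartite m n).
  pose r x y := arc (f x) (f y).
  (* Either the vertices are on different sides and exactly one arc joins them, or they are on the
     same side and there is none. *)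
  have rE x y : (r x y = ~~ r y x /\ side x != side y) \/
                ([/\ r x y = false, r y x = false & side x = side y]).
    have [] := arcP (f x) (f y); rewrite -/(r x y) -/(r y x).
    rewrite -[edge _ _]/(side x != side y).
    by case: (r x y) (r y x) (eqVneq (side x) (side y)) => [] [] [e|e] //= _ _;
      [left|left|right].
  have rD x y : side x != side y -> r y x = ~~ r x y.
    by case: (rE x y) => [[-> _]|[_ _ ->]]; rewrite ?negbK ?eqxx.
  have rS x y : side x = side y -> r x y = false.
    by case: (rE x y) => [[_ /eqP ne] /ne|[-> _ _]].
  have eE x y : edge x y =
      (x != y) && [exists z, r x z && r y z || r z x && r z y].
    rewrite -fE /= /niche_rel (bij_eq fbij); congr (_ && _).
    apply/existsP/existsP=> [[z zP]|[z zP]]; last by exists (f z).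
    by exists (g z); rewrite /r gK.
  exists [set x | side x], r; split.
  - apply/set0Pn; exists (g (existT _ true (Ordinal m0))).
    by rewrite inE /side gK.
  - apply/set0Pn; exists (g (existT _ false (Ordinal n0))).
    by rewrite !inE /side gK.
  - move=> u v; rewrite !inE => su /negbTE sv; rewrite eE negb_and.
    apply/orP; right; apply/existsPn=> z.
    case sz : (side z).
      by rewrite (rS u z) ?(rS z u) ?su ?sz.
    by rewrite (rS v z) ?(rS z v) ?sv ?sz ?andbF.
  - move=> u v; rewrite !inE => su sv; rewrite eE; congr (_ && _).
    apply: eq_existsb => z; rewrite !inE; case sz : (side z) => /=.
      by rewrite !rS ?su ?sv ?sz.
    rewrite (rD u z) ?su ?sz // (rD v z) ?sv ?sz //.
    by case: (r u z) (r v z) => [] [].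
  - move=> u v; rewrite !inE => /negbTE su /negbTE sv; rewrite eE; congr (_ && _).
    apply: eq_existsb => z; rewrite !inE negbK; case sz : (side z) => /=.
      rewrite (rD u z) ?su ?sz // (rD v z) ?sv ?sz //.
      by case: (r u z) (r v z) => [] [].
    by rewrite !rS ?su ?sv ?sz.
case=> C [r [/set0Pn[u0 u0C] /set0Pn[w0 w0C] cross sC sD]].
pose V := complete_bipartite #|C| #|~: C|.
pose g (z : V) : G :=
  match z with
  | existT true i => enum_val (i : 'I_#|C|)
  | existT false i => enum_val (i : 'I_#|~: C|)
  end.
pose in1 (i : 'I_#|C|) : V :=
  existT (fun b : bool => 'I_(if b then #|C| else #|~: C|)) true i.
pose in2 (i : 'I_#|~: C|) : V :=
  existT (fun b : bool => 'I_(if b then #|C| else #|~: C|)) false i.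
have gC z : (g z \in C) = tag z.
  by case: z => [[] i] /=; have := enum_valP i; rewrite ?inE // => /negbTE.
have ginj : injective g.
  move=> z1 z2 e; have := gC z1; rewrite e gC.
  by case: z1 z2 e => [[] i] [[] j] //= /enum_val_inj->.
have gbij : bijective g.
  apply: inj_card_bij ginj (@leq_card_surj _ _ g _) => x.
  have [xC|xC] := boolP (x \in C).
    by exists (in1 (enum_rank_in xC x)); exact: (enum_rankK_in xC xC).
  have xD : x \in ~: C by rewrite inE.
  by exists (in2 (enum_rank_in xD x)); exact: (enum_rankK_in xD xD).
(* Entries of [r] are read from [C] to its complement; a false entry gives the reverse arc. *)
pose arc (x y : V) := if tag x then ~~ tag y && r (g x) (g y)
                      else tag y && ~~ r (g y) (g x).
exists #|C|, #|~: C|, arc; split.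
- by apply/card_gt0P; exists u0.
- by apply/card_gt0P; exists w0.
- move=> x y; rewrite -[edge x y]/(tag x != tag y) /arc.
  by case: (tag x) (tag y) (r (g x) (g y)) (r (g y) (g x)) => [] [] [] [].
case: (gbij) => f gK fK; exists f; first by exists g.
suff gE x y : edge (g x) (g y) = niche_rel arc x y.
  by move=> x y; rewrite -[edge _ _]/(niche_rel arc (f x) (f y)) -gE !fK.
have exg (B : pred G) : [exists w, B w] = [exists z, B (g z)].
  by apply/existsP/existsP=> [[w Bw]|[z Bz]]; [exists (f w); rewrite fK | exists (g z)].
have gD z : (g z \in ~: C) = ~~ tag z by rewrite inE gC.
rewrite /niche_rel -(inj_eq ginj).
case tx : (tag x); case ty : (tag y).
- rewrite sC ?gC ?tx ?ty // exg; congr (_ && _); apply: eq_existsb => z.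
  rewrite gD /arc tx ty; case: (tag z) => //=.
  by case: (r _ _) (r _ _) => [] [].
- rewrite (negbTE (cross _ _ _ _)) ?gC ?gD ?tx ?ty //; apply/esym/negbTE.
  rewrite negb_and; apply/orP; right; apply/existsPn=> z.
  by rewrite /arc tx ty; case: (tag z); rewrite /= ?andbF.
- rewrite edge_sym (negbTE (cross _ _ _ _)) ?gC ?gD ?tx ?ty //.
  apply/esym/negbTE; rewrite negb_and; apply/orP; right; apply/existsPn=> z.
  by rewrite /arc tx ty; case: (tag z); rewrite /= ?andbF.
- rewrite sD ?gD ?tx ?ty // exg; congr (_ && _); apply: eq_existsb => z.
  rewrite inE gD negbK /arc tx ty; case: (tag z) => //=.
  by case: (r _ _) (r _ _) => [] [].
Qed.

(** * From a separating matrix to a niche graph *)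

(* The rows of [M] are pairwise distinct up to complement. *)
Definition separates (P P' : finType) (M : P -> P' -> bool) : Prop :=
  forall x x' c, (forall y, M x y = c (+) M x' y) -> x = x'.

(** Flipping [t u] complements the row of [u]. Hence rows in one class are equal or complementary
    according to [t], while rows in different classes are never complementary, since [M]
    separates. *)
Lemma twin_paired_niche_side (G : sgraph) (C : {set G}) (P P' : finType)
    (M : P -> P' -> bool) (r : G -> G -> bool)
    (q : G -> P) (t : G -> bool) (q' : G -> P') (t' : G -> bool) :
  separates M -> ~: C != set0 ->
  (forall p, exists2 w, w \in ~: C & q' w = p) ->
  {in C &, forall x y,
    edge x y = (x != y) && ((q x != q y) || (t x == t y))} ->
  {in C & ~: C, forall u w, r u w = M (q u) (q' w) (+) (t u (+) t' w)} ->
  niche_side C r.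
Proof.
move=> sepM /set0Pn[w0 w0C] q's qE rE u v uC vC; rewrite qE //; congr (_ && _).
apply/idP/existsP=> [|[w /andP[wC]]]; last first.
  rewrite !rE //; case: (eqVneq (q u) (q v)) => //= ->.
  by case: (M _ _) (t u) (t v) (t' w) => [] [] [] [].
have [quv /= tuv|quv _] := eqVneq (q u) (q v).
  (* Equal rows still need a column in which to agree, hence the nonempty complement. *)
  by exists w0; rewrite w0C !rE //= quv (eqP tuv).
apply/existsP; apply: contraNT quv => /existsPn nw; apply/eqP.
(* If the rows never agree, cancelling [t' w] leaves rows of [M] that differ by this constant. *)
apply: (sepM _ _ (~~ (t u (+) t v))) => p; have [w wC <-] := q's p.
have := nw w; rewrite wC !rE //=.
by case: (M _ _) (M _ _) (t u) (t v) (t' w) => [] [] [] [] [].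
Qed.

(** * Normalized matrices and the exponential bounds *)

(** Complementing rows and columns clears row [u0] and column [w0]. Two rows of [r] are equal or
    complementary exactly when their normalized rows are equal. *)
Definition normalize (T : Type) (r : T -> T -> bool) (u0 w0 u w : T) : bool :=
  r u w (+) r u w0 (+) (r u0 w (+) r u0 w0).

Lemma normalizeC (T : Type) (r : T -> T -> bool) (u0 w0 u w : T) :
  normalize (fun x y => r y x) w0 u0 w u = normalize r u0 w0 u w.
Proof.
by rewrite /normalize; case: (r u w) (r u w0) (r u0 w) (r u0 w0) => [] [] [] [].
Qed.

Definition row (T : finType) (B : {set T}) (N : T -> T -> bool) (u : T) :=
  [set w in B | N u w].

(** A row is determined by the set of column classes in which it has a one. None of these is the
    zero class, which does occur because of [w0]; this accounts for the [- 1] in the exponent. *)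
Lemma card_rows (T : finType) (A B : {set T}) (N N' : T -> T -> bool) (w0 : T) :
  (forall u w, N' w u = N u w) -> w0 \in B -> (forall u, N u w0 = false) ->
  #|[set row B N u | u in A]| <= 2 ^ (#|[set row A N' w | w in B]| - 1).
Proof.
move=> N'E w0B Nw0; set R := [set _ | u in A]; set S := [set _ | w in B].
have S0 : set0 \in S.
  apply/imsetP; exists w0 => //; apply/setP=> u.
  by rewrite !inE N'E Nw0 andbF.
have colP u w : u \in A -> w \in B ->
    (row A N' w \in row A N' @: row B N u) = (w \in row B N u).
  move=> uA wB; apply/idP/idP=> [/imsetP[w']|]; last by apply: imset_f.
  rewrite !inE wB => /andP[_ Nuw'] /setP/(_ u).
  by rewrite !inE uA !N'E Nuw' /= => ->.
have Rinj : {in R &, injective (fun X : {set T} => row A N' @: X)}.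
  move=> _ _ /imsetP[u uA ->] /imsetP[v vA ->] e; apply/setP=> w.
  have [wB|wB] := boolP (w \in B); first by rewrite -!colP // e.
  by rewrite !inE (negbTE wB).
rewrite -(card_in_imset Rinj).
(* The images of rows are subsets of the nonzero column classes. *)
have -> : #|S| - 1 = #|S :\ set0| by rewrite (cardsD1 set0 S) S0 add1n subn1.
rewrite -card_powerset; apply/subset_leq_card/subsetP=> _ /imsetP[_ /imsetP[u uA ->] ->].
rewrite inE; apply/subsetP=> _ /imsetP[w + ->]; rewrite inE => /andP[wB Nuw].
rewrite !inE imset_f // andbT; apply/set0Pn; exists u.
by rewrite inE uA N'E.
Qed.

(** The class of [u] is its normalized row, and its entry at [w0] tells the row from its complement.
    The row of [u0] is the default outside [C]. *)
Lemma niche_side_twin_paired (G : sgraph) (C : {set G}) (r : G -> G -> bool)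
    (u0 w0 : G) :
  niche_side C r -> u0 \in C -> w0 \in ~: C ->
  twin_paired C {X | X \in [set row (~: C) (normalize r u0 w0) u | u in C]}.
Proof.
move=> rE u0C w0C; set rw := row _ _; set R := [set _ | _ in _].
have rwR u : u \in C -> rw u \in R by apply: imset_f.
exists (fun u => insubd (Sub (rw u0) (rwR u0 u0C)) (rw u)), (fun u => r u w0).
split=> [[X XR]|u v uC vC].
  have /imsetP[u uC Xu] := XR; exists u => //.
  by apply: val_inj; rewrite val_insubd /= rwR.
rewrite rE // -val_eqE !val_insubd !rwR //; congr (_ && _).
apply/existsP/idP=> [[w /andP[wC ruv]]|H].
  apply: contraTT ruv; rewrite negb_or negbK => /andP[/eqP/setP/(_ w)].
  rewrite !inE -in_setC wC /= /normalize.
  by case: (r u w) (r v w) (r u w0) (r v w0) (r u0 w (+) r u0 w0) => [] [] [] [] [].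
apply/existsP; apply: contraTT H => /existsPn nw.
have {}nw w : w \in ~: C -> r u w = ~~ r v w.
  by move=> wC; have := nw w; rewrite wC /=; case: (r u w) (r v w) => [] [].
rewrite negb_or negbK nw //; apply/andP; split; last by case: (r v w0).
apply/eqP/setP=> w; rewrite [LHS]inE [RHS]inE.
have [wC|] //= := boolP (w \in ~: C); rewrite /normalize !nw //.
by case: (r v w) (r v w0) => [] [].
Qed.

(** * Construction of separating matrices *)

Lemma separating_matrix_le (P P' : finType) :
  0 < #|P| <= #|P'| -> #|P'| <= 2 ^ (#|P| - 1) ->
  exists2 M : P -> P' -> bool, separates M & separates (fun y x => M x y).
Proof.
case/andP=> /card_gt0P[p0 _] leP leP'.
pose F := powerset (~: [set p0]).
(* The empty set, arising from [x = p0], and the singletons of the other points. *)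
pose F0 := [set [set x] :\ p0 | x : P].
have F0F : F0 \subset F.
  by apply/subsetP=> _ /imsetP[x _ ->]; rewrite inE setDE subsetIr.
have cF : #|F| = 2 ^ (#|P| - 1).
  by rewrite card_powerset cardsC1 subn1.
(* Listing [F0] first ensures that the first [#|P'|] sets, used as columns, include all of it, as
   [F0] has at most [#|P|] members. *)
pose s := enum F0 ++ enum (F :\: F0).
have us : uniq s.
  rewrite cat_uniq !enum_uniq andbT; apply/hasPn=> X.
  by rewrite !mem_enum inE => /andP[].
have ss : size s = 2 ^ (#|P| - 1).
  by rewrite size_cat -!cardE -cF -(cardsID F0 F) (setIidPr F0F).
pose g (y : P') := nth set0 s (enum_rank y).
have gs (y : P') : enum_rank y < size s.
  by rewrite ss; apply: leq_trans leP'.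
have ginj : injective g.
  by move=> y y' /eqP; rewrite nth_uniq // => /eqP/val_inj/enum_rank_inj.
have gp0 y : p0 \notin g y.
  have : g y \in s by apply: mem_nth.
  have gF : g y \in s -> g y \in F.
    rewrite mem_cat !mem_enum => /orP[/(subsetP F0F)//|].
    by rewrite inE => /andP[].
  by move/gF; rewrite inE => /subsetP H; apply/negP=> /H; rewrite !inE eqxx.
have gF0 x : exists y, g y = [set x] :\ p0.
  have xF : [set x] :\ p0 \in F0 by apply: imset_f.
  have iF : index ([set x] :\ p0) (enum F0) < #|F0|.
    by rewrite cardE index_mem mem_enum.
  have iP : index ([set x] :\ p0) (enum F0) < #|P'|.
    by apply: leq_trans iF (leq_trans (leq_imset_card _ _) leP).
  exists (enum_val (Ordinal iP)); rewrite /g enum_valK /= nth_cat -cardE iF.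
  by rewrite nth_index // mem_enum.
exists (fun x y => x \in g y) => [x x' c H|y y' c H].
  (* The empty column excludes complementation; the singleton columns then distinguish rows. *)
  have c0 : c = false.
    have [y gy] := gF0 p0; have := H y; rewrite gy setDv !inE.
    by case: c {H}.
  have [//|xx'] := eqVneq x x'.
  have [y gy] := gF0 x; have [y' gy'] := gF0 x'.
  have := H y; have := H y'; rewrite gy gy' c0 !inE !eqxx (eq_sym x' x) (negbTE xx').
  rewrite !andbT !andbF /= => /esym/negbFE/eqP x'p0 /negbFE/eqP xp0.
  by rewrite xp0 x'p0.
(* The zero row [p0] excludes complementation of columns. *)
have c0 : c = false by have := H p0; rewrite !(negbTE (gp0 _)); case: c {H}.
by apply: ginj; apply/setP=> x; rewrite H c0.
Qed.

Lemma separating_matrix (P P' : finType) :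
  0 < #|P| <= 2 ^ (#|P'| - 1) -> 0 < #|P'| <= 2 ^ (#|P| - 1) ->
  exists2 M : P -> P' -> bool, separates M & separates (fun y x => M x y).
Proof.
case/andP=> P0 leP /andP[P'0 leP'].
have [le|/ltnW le] := leqP #|P| #|P'|.
  by apply: separating_matrix_le => //; rewrite P0.
have [|M MP MP'] := @separating_matrix_le P' P _ leP; first by rewrite P'0.
by exists (fun x y => M y x).
Qed.

(** * Graphs with two components *)

(** The last clause identifies the parts of the tournament: a proper nonempty set with no edges
    leaving it is a union of components, hence one of the two. *)
Lemma two_components (G : sgraph) (C1 C2 : {set G}) :
  C1 <> C2 -> components G = [set C1; C2] ->
  [/\ C2 = ~: C1, C1 != set0, C2 != set0,
      {in C1 & ~: C1, forall u v, ~~ edge u v} &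
      forall C : {set G}, C != set0 -> ~: C != set0 ->
        {in C & ~: C, forall u v, ~~ edge u v} -> C = C1 \/ C = C2].
Proof.
move=> neq comp; pose cl (x : G) := [set y | connect edge x y].
have esym : connect_sym (@edge G) := sym_connect_sym (@edge_sym G).
have compE : components G = [set cl x | x : G].
  apply/setP=> X; apply/imsetP/imsetP=> -[x _ ->]; exists x => //;
    by apply/setP=> y; rewrite !inE.
have clE x y : connect edge x y -> cl x = cl y.
  by move=> xy; apply/setP=> z; rewrite !inE (same_connect esym xy).
have clC x : cl x = C1 \/ cl x = C2.
  have : cl x \in components G by rewrite compE imset_f.
  by rewrite comp !inE => /orP[] /eqP; auto.
have [x1 C1E] : exists x, C1 = cl x.
  have : C1 \in components G by rewrite comp !inE eqxx.
  by rewrite compE => /imsetP[x _ ->]; exists x.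
have [x2 C2E] : exists x, C2 = cl x.
  have : C2 \in components G by rewrite comp !inE eqxx orbT.
  by rewrite compE => /imsetP[x _ ->]; exists x.
have C2C : C2 = ~: C1.
  apply/setP=> y; rewrite !inE; apply/idP/idP=> [yC2|].
    apply/negP=> yC1; apply: neq; move: yC1 yC2.
    by rewrite C1E C2E !inE => /clE-> /clE->.
  have [<-|<-] := clC y; last by rewrite inE connect0.
  by rewrite inE connect0.
split=> //.
- by rewrite C1E; apply/set0Pn; exists x1; rewrite inE.
- by rewrite C2E; apply/set0Pn; exists x2; rewrite inE.
- move=> u v uC; rewrite inE; apply: contra => uv.
  by move: uC; rewrite C1E !inE => x1u; apply: connect_trans (connect1 uv).
move=> C /set0Pn[u0 u0C] /set0Pn[w0 w0C] cross.
have clos : closed (@edge G) (mem C).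
  apply: (intro_closed esym) => x y xy xC; apply: contraTT xy => yC.
  by apply: cross; rewrite ?inE.
have clsub x : forall y, y \in cl x -> (y \in C) = (x \in C).
  by move=> y; rewrite inE => /(closed_connect clos)->.
have u0w0 : cl u0 <> cl w0.
  move=> e; have : w0 \in cl u0 by rewrite e inE.
  by move/clsub; rewrite u0C; move: w0C; rewrite inE => /negbTE->.
(* The components of [u0] and [w0] differ, so they are the two components of [G]. *)
have subC : cl u0 = ~: cl w0.
  case: (clC u0) (clC w0) u0w0 => -> [] -> //.
  by rewrite C2C setCK.
suff -> : C = cl u0 by [].
apply/setP=> y; have [yu|yu] := boolP (y \in cl u0).
  by rewrite (clsub _ _ yu) u0C.
move: yu; rewrite subC inE negbK => /clsub->.
by move: w0C; rewrite inE => /negbTE.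
Qed.

(** * The characterization *)

(** Normalizing the transpose at [w0] and [u0] transposes the normalized matrix, so both bounds come
    from one matrix, counted by rows and by columns. *)
Lemma niche_twin_paired (G : sgraph) (C : {set G}) (r : G -> G -> bool) :
  C != set0 -> ~: C != set0 ->
  niche_side C r -> niche_side (~: C) (fun u v => r v u) ->
  exists P P' : finType,
    [/\ twin_paired C P, twin_paired (~: C) P',
        0 < #|P| <= 2 ^ (#|P'| - 1) & 0 < #|P'| <= 2 ^ (#|P| - 1)].
Proof.
move=> /set0Pn[u0 u0C] /set0Pn[w0 w0D] rC rD.
have u0DC : u0 \in ~: ~: C by rewrite setCK.
have tC := niche_side_twin_paired rC u0C w0D.
have tD := niche_side_twin_paired rD w0D u0DC.
rewrite setCK in tD.
do 2![eexists]; split; [exact: tC | exact: tD | |]; rewrite !card_sig.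
  apply/andP; split.
    by apply/card_gt0P; eexists; apply: imset_f u0C.
  apply: (@card_rows _ _ _ _ _ w0) => //; first exact: normalizeC.
  by move=> u; rewrite /normalize !addbb.
apply/andP; split.
  by apply/card_gt0P; eexists; apply: imset_f w0D.
apply: (@card_rows _ _ _ _ _ u0) => // [u w|u]; first by rewrite normalizeC.
by rewrite /normalize !addbb.
Qed.

Theorem theorem3p6 (G : sgraph) (C1 C2 : {set G})
    (hneq : C1 <> C2) (hcomp : components G = [set C1; C2]) :
  niche_realizable G <->
  exists a1 b1 a2 b2 : nat,
    2 * a1 + b1 <= #|induced C1| /\
    2 * a2 + b2 <= #|induced C2| /\
    1 <= a1 + b1 <= 2 ^ (a2 + b2 - 1) /\
    1 <= a2 + b2 <= 2 ^ (a1 + b1 - 1) /\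
    is_expansion (induced C1) (complete_multipartite21 a1 b1) /\
    is_expansion (induced C2) (complete_multipartite21 a2 b2).
Proof.
have [C2C C10 C20 cross C12] := two_components hneq hcomp.
split=> [/niche_realizableP[C [r [C0 D0 crossC rC rD]]]|].
  have [P [P' [tP tP' cP cP']]] := niche_twin_paired C0 D0 rC rD.
  move: cP cP'; have [a [b [<- ab ex]]] := twin_paired_expansion tP.
  have [a' [b' [<- ab' ex']]] := twin_paired_expansion tP' => cP cP'.
  (* The part [C] may be either component; in the second case the two pairs of integers are
     exchanged. *)
  have [CE|CE] := C12 C C0 D0 crossC.
    by exists a, b, a', b'; rewrite C2C -CE.
  exists a', b', a, b; rewrite -[C1]setCK -C2C -CE.
  by do ![split].
case=> a1 [b1 [a2 [b2 [_ [_ [c1 [c2 [ex1 ex2]]]]]]]].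
have [q1 [t1 [q1s q1E]]] := expansion_twin_paired (proj1 (andP c1)) ex1.
have [q2 [t2 [q2s q2E]]] := expansion_twin_paired (proj1 (andP c2)) ex2.
have [||M MP MP'] := @separating_matrix ('I_a1 + 'I_b1)%type ('I_a2 + 'I_b2)%type.
- by rewrite !card_sum !card_ord.
- by rewrite !card_sum !card_ord.
rewrite C2C in C20 q2s q2E.
apply/niche_realizableP.
(* Each entry of [M] is blown up over its two classes, and the bits [t1], [t2] complement rows and
   columns within them. *)
exists C1, (fun u w => M (q1 u) (q2 w) (+) (t1 u (+) t2 w)); split=> //.
  exact: (twin_paired_niche_side MP C20 q2s q1E).
apply: (twin_paired_niche_side (t' := t1) MP' _ _ q2E); rewrite ?setCK //.
by move=> u w _ _; rewrite (addbC (t1 w)).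
Qed.
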